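(* For every connected graph $G$ the following assertions are equivalent: (i) $G$ is not countably determined. (ii) $G$ has an uncountable star-decomposition of finite adhesion such that in every leaf part there lives a direction of $G$.
   Context: Graphs may be infinite of any cardinality. Countable means finite or countably infinite. A ray is a one-way infinite path. Two rays in $G$ are equivalent if no finite set of vertices separates them; the equivalence classes are the ends of $G$. A direction of $G$ is a map $f$ that assigns to every finite set $X\subseteq V(G)$ a component $f(X)$ of $G-X$ such that $f(X)\supseteq f(X')$ whenever $X\subseteq X'$. Every end $\omega$ of $G$ defines a direction $f_\omega$, where $f_\omega(X)$ is the component of $G-X$ containing a tail of every ray in $\omega$; the map $\omega\mapsto f_\omega$ is a bijection between the ends and the directions of $G$, and $\omega_f$ denotes the unique end with $f_{\omega_f}=f$. A directional choice in $G$ is a pair $(X,C)$ of a finite set $X\subseteq V(G)$ and a component $C$ of $G-X$. It distinguishes a direction $f$ from another direction $h$ if $f(X)=C$ and $h(X)\neq C$. The graph $G$ is countably determined if there is a countable set of directional choices in $G$ that distinguish every two directions of $G$ from each other (i.e. for any two distinct directions $f,h$, some directional choice in the set distinguishes $f$ from $h$). A tree-decomposition of $G$ is a pair $(T,\mathcal V)$ of a tree $T$ and a family $\mathcal V=(V_t)_{t\in V(T)}$ of parts $V_t\subseteq V(G)$ such that $V(G)=\bigcup_t V_t$, every edge of $G$ has both endvertices in some $V_t$, and $V_{t_1}\cap V_{t_3}\subseteq V_{t_2}$ whenever $t_2$ lies on the path $t_1Tt_3$. It has finite adhesion if $V_{t_1}\cap V_{t_2}$ is finite for every edge $t_1t_2$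 of $T$. An uncountable star-decomposition is a tree-decomposition whose tree is a star $K_{1,\kappa}$ with $\kappa$ an uncountable cardinal; the parts of its leaves are the leaf parts. If $(T,\mathcal V)$ has finite adhesion, an end $\omega$ of $G$ lives in a part $V_t$ if some (equivalently, every) ray in $\omega$ has infinitely many vertices in $V_t$; a direction $f$ lives in the part in which $\omega_f$ lives. *)

(* Defs.v *)
From mathcomp Require Import all_boot finmap.
From mathcomp Require Import boolp classical_sets functions cardinality.

Set Implicit Arguments.
Unset Strict Implicit.
Unset Printing Implicit Defensive.

Local Open Scope fset_scope.
Local Open Scope classical_set_scope.

(* Simple graphs of arbitrary cardinality.  Classically ([boolp]) every type
   carries a [choiceType] structure ([{classic V}]) and every relation is
   boolean, so these choices do not restrict the graphs considered. *)
Record graph := Graph {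
  vertex :> choiceType;
  adj : rel vertex;
  adj_sym : symmetric adj;
  adj_irr : irreflexive adj
}.

Section Graphs.
Variable G : graph.

Implicit Types (A B C : set G) (X : {fset G}) (x y : G) (p : seq G).

(* [x :: p] is the vertex sequence of a path (no repeated vertices) from [x]
   to [y]. *)
Definition gpath x y p : Prop :=
  [/\ path (@adj G) x p, uniq (x :: p) & last x p = y].

Definition connected_set A : Prop :=
  A !=set0 /\
  forall x y, A x -> A y -> exists2 p, gpath x y p & [set` x :: p] `<=` A.

Definition connected_graph : Prop := connected_set [set: G].

(* Components are maximal connected induced subgraphs, represented by their
   vertex sets. *)
Definition is_component X C : Prop :=
  [/\ C `<=` ~` [set` X], connected_set C &
      forall B, B `<=` ~` [set` X] -> connected_set B -> C `<=` B -> B = C].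

Definition is_ray (r : nat -> G) : Prop :=
  injective r /\ forall n, adj (r n) (r n.+1).

Definition separates X A B : Prop :=
  forall x y p, A x -> B y -> gpath x y p ->
    exists2 z, z \in x :: p & z \in X.

Definition ray_equiv (r s : nat -> G) : Prop :=
  forall X, ~ separates X (range r) (range s).

Definition is_end (w : set (nat -> G)) : Prop :=
  exists2 r, is_ray r & w = [set s | is_ray s /\ ray_equiv r s].

Definition is_direction (f : {fset G} -> set G) : Prop :=
  (forall X, is_component X (f X)) /\
  forall X X', (X `<=` X')%fset -> f X' `<=` f X.

(* For an end [w] and a direction [f], this says that [f] is the direction
   [f_w] defined by [w], equivalently that [w] is the end [w_f]. *)
Definition end_direction (w : set (nat -> G)) (f : {fset G} -> set G) : Prop :=
  forall X r, w r -> exists n, forall m, n <= m -> f X (r m).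

Definition directional_choice (d : {fset G} * set G) : Prop :=
  is_component d.1 d.2.

Definition distinguishes (d : {fset G} * set G) (f h : {fset G} -> set G) :
    Prop :=
  f d.1 = d.2 /\ h d.1 <> d.2.

Definition countably_determined : Prop :=
  exists D : set ({fset G} * set G),
    [/\ countable D, D `<=` directional_choice &
        forall f h, is_direction f -> is_direction h -> f <> h ->
          exists2 d, D d & distinguishes d f h].

Definition is_tree : Prop :=
  connected_graph /\ forall c, 2 < size c -> ~ ucycle (@adj G) c.

(* [G] is a star with centre [c]; its leaves are the vertices other than [c]
   as soon as there are at least two of them. *)
Definition is_star (c : G) : Prop :=
  forall x y, adj x y = ((x == c) (+) (y == c)).

End Graphs.

Section TreeDecompositions.
Variables (G T : graph) (V : T -> set G).

Definition tree_decomposition : Prop :=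
  [/\ is_tree T,
      \bigcup_t V t = [set: G],
      forall x y : G, adj x y -> exists t, V t x /\ V t y &
      forall (t1 t2 t3 : T) p, gpath t1 t3 p -> t2 \in t1 :: p ->
        V t1 `&` V t3 `<=` V t2].

Definition finite_adhesion : Prop :=
  forall t1 t2 : T, adj t1 t2 -> finite_set (V t1 `&` V t2).

(* The leaves of the star form the set [[set~ c]], so the star is K_{1,k}
   with k the cardinality of that set. *)
Definition uncountable_star_decomposition (c : T) : Prop :=
  [/\ tree_decomposition, is_star c & ~ countable [set~ c]].

Definition end_lives_in (w : set (nat -> G)) (t : T) : Prop :=
  exists2 r, w r & infinite_set (range r `&` V t).

Definition direction_lives_in (f : {fset G} -> set G) (t : T) : Prop :=
  exists w, [/\ is_end w, end_direction w f & end_lives_in w t].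

End TreeDecompositions.

(* Main.v *)
Require Import Defs.
From mathcomp Require Import all_boot finmap.
From mathcomp Require Import boolp classical_sets functions cardinality.

Set Implicit Arguments.
Unset Strict Implicit.
Unset Printing Implicit Defensive.

Local Open Scope fset_scope.
Local Open Scope classical_set_scope.

(* Call a region a set [f X] for a direction [f] and a finite [X], and call two
   sets far apart if they are disjoint and no edge joins them.  Both (i) and
   (ii) are equivalent to the existence of an uncountable far-apart family of
   regions.

   For (ii) this is a matter of taking closed neighbourhoods of regions as leaf
   parts, and of finding a ray inside every region.

   If all far-apart families of regions are countable, then a pressing-down
   argument on countable vertex sets yields a countable [U] that meets every
   region.  Closing [U] under paths that avoid finite subsets of [U], the
   choices [(Y, f Y)] with [Y] a finite subset of [U] distinguish all
   directions, and there are countably many of them.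

   Conversely let countably many choices distinguish all directions, let [U] be
   a countable path-closed set containing all their vertices, and let the region
   [L] of [f] miss [U].  If [f Y] met [U] for all finite [Y] in [U], then [U]
   would contain a sequence converging to a direction other than [f] with the
   same choices as [f].  So some [K = f Y] misses [U]; it is a component of
   [G - N(K)] with [N(K)] a finite subset of [U].  Each [N(K)] accounts for
   countably many regions, as the only choice that can tell such a component
   from another one with the same neighbourhood is the component itself. *)

(** * Countable sets, closures and pressing down *)

Lemma countable_inj (I J : Type) (h : I -> J) (A : set I) (B : set J) :
  (forall x y, A x -> A y -> h x = h y -> x = y) ->
  (forall x, A x -> B (h x)) -> countable B -> countable A.
Proof.
move=> hI hB /countable_injP[g gI]; apply/countable_injP.
exists (g \o h) => x y; rewrite !inE => Ax Ay /= e.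
by apply: hI => //; apply: gI; rewrite ?inE //; exact: hB.
Qed.

Lemma countable_subset (I : Type) (A B : set I) :
  A `<=` B -> countable B -> countable A.
Proof. by move=> AB; apply: (countable_inj (h := id)). Qed.

Lemma countable_setU (I : Type) (A B : set I) :
  countable A -> countable B -> countable (A `|` B).
Proof.
by move=> cA cB; rewrite -bigcup2E; apply: bigcup_countable => // -[|[|i]].
Qed.

Lemma countable_fsubsets (V : choiceType) (U : set V) :
  countable U -> countable [set Y : {fset V} | [set` Y] `<=` U].
Proof.
move=> /countable_finite_subset.
apply: (countable_inj (h := fun Y : {fset V} => [set` Y])) => [X Y _ _ XY|Y YU].
  by rewrite -[X]set_fsetK XY set_fsetK.
by split.
Qed.

Lemma fset_sub_bigcup (V : choiceType) (W : nat -> set V) (Y : {fset V}) :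
  (forall n, W n `<=` W n.+1) -> [set` Y] `<=` \bigcup_n W n ->
  exists n, [set` Y] `<=` W n.
Proof.
move=> Winc YW.
have Wle m n : m <= n -> W m `<=` W n.
  elim: n => [|n IHn]; first by rewrite leqn0 => /eqP->.
  by rewrite leq_eqVlt => /predU1P[->//|/IHn mn]; exact: subset_trans mn _.
suff [n nP] : exists n, forall x, x \in enum_fset Y -> W n x by exists n.
have : forall x, x \in enum_fset Y -> (\bigcup_n W n) x by [].
elim: (enum_fset Y) => [|x s IHs] sW; first by exists 0.
have [m _ mx] := sW x (mem_head _ _).
have [|n ns] := IHs; first by move=> y ys; apply: sW; rewrite inE ys orbT.
exists (maxn m n) => y; rewrite inE => /predU1P[->|/ns yn].
  exact: Wle (leq_maxl _ _) _ mx.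
exact: Wle (leq_maxr _ _) _ yn.
Qed.

(** [step] is iterated omega times; a finite subset of the union already lies in one stage, so its
    image under [e] lies in the next. *)
Lemma countable_closure (V : choiceType) (e : {fset V} -> set V) :
  (forall Y, countable (e Y)) ->
  exists2 U, countable U & forall Y : {fset V}, [set` Y] `<=` U -> e Y `<=` U.
Proof.
move=> ce.
pose step W := W `|` \bigcup_(Y in [set Y : {fset V} | [set` Y] `<=` W]) e Y.
pose W n := iter n step set0; exists (\bigcup_n W n).
  apply: bigcup_countable => // n _; elim: n => [|n IHn] //=.
  apply: (countable_setU IHn).
  by apply: bigcup_countable => //; exact: countable_fsubsets.
move=> Y YW; have [n Yn] : exists n, [set` Y] `<=` W n.
  by apply: fset_sub_bigcup => // n x; left.
by move=> x ex; exists n.+1 => //; right; exists Y.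
Qed.

(* Fodor's lemma, with the countable sets closed under some [e] in the role of
   the closed unbounded subsets of omega_1. *)
Lemma pressing_down (V : choiceType) (F : set V -> {fset V}) :
  (forall U, countable U -> [set` F U] `<=` U) ->
  exists X, forall e : {fset V} -> set V, (forall Y, countable (e Y)) ->
    exists U, [/\ countable U,
      forall Y : {fset V}, [set` Y] `<=` U -> e Y `<=` U & F U = X].
Proof.
move=> FU; apply: contrapT => /forallNP noX.
have {noX} /choice[e eP] : forall X, exists e : {fset V} -> set V,
    (forall Y, countable (e Y)) /\ forall U, countable U ->
    (forall Y : {fset V}, [set` Y] `<=` U -> e Y `<=` U) -> F U <> X.
  move=> X; have /existsNP[e /not_implyP[ce /forallNP eP]] := noX X.
  by exists e; split=> // U cU eU FX; apply: (eP U).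
(* A diagonal intersection: since [F U] lies in the countable set [U], closure under [d] gives
   closure under [e (F U)]. *)
pose d (Z : {fset V}) := \bigcup_(p in [set p : {fset V} * {fset V} |
  [set` p.1] `<=` [set` Z] /\ [set` p.2] `<=` [set` Z]]) e p.1 p.2.
have [Z|U cU dU] := @countable_closure _ d.
  apply: bigcup_countable => [|p _]; last exact: (eP _).1.
  apply: countable_subset (countableX (countable_fsubsets (countable_fset Z))
    (countable_fsubsets (countable_fset Z))).
  by move=> [p q] [].
apply: (eP (F U)).2 (erefl) => // Y YU x ex.
apply: (dU (F U `|` Y)%fset); last first.
  by exists (F U, Y) => //; split=> z /= zF; rewrite inE zF ?orbT.
by move=> z /=; rewrite inE => /orP[/(FU _ cU)|/YU].
Qed.

Lemma maximal_pairwise (I : Type) (R : I -> I -> Prop) (S : set I) :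
  (forall x y, R x y -> R y x) ->
  exists M, [/\ M `<=` S, forall x y, M x -> M y -> x <> y -> R x y &
    forall x, S x -> M x \/ exists2 y, M y & ~ R x y].
Proof.
move=> Rsym.
pose P (M : set I) := M `<=` S /\ forall x y, M x -> M y -> x <> y -> R x y.
have [|M [[MS MR] Mmax]] := @Zorn_bigcup _ P.
  move=> F FP Ftot; split=> [x [A FA Ax]|x y [A FA Ax] [B FB By]].
    exact: (FP _ FA).1.
  have [AB|BA] := Ftot A B FA FB.
    by apply: (FP _ FB).2 => //; exact: AB.
  by apply: (FP _ FA).2 => //; exact: BA.
exists M; split=> // x Sx; apply: contrapT => /not_orP[Mx /forall2NP xR].
have xRy y : M y -> R x y by move=> My; have [//|/contrapT] := xR y.
apply: (Mmax (x |` M)).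
  split; first by move=> y; right.
  by move=> /(_ x (or_introl erefl)).
split=> [y [->//|/MS//]|y z [->|My] [->|Mz] // yz].
- exact: xRy.
- by apply: Rsym; exact: xRy.
- exact: MR.
Qed.

(** * Walks inside a set, and components *)

Section Linked.
Variable G : graph.
Implicit Types (A B : set G) (X Y : {fset G}) (x y z : G) (p : seq G).

(** Walks may repeat vertices, which makes concatenation immediate; [linked_gpath] shortens them
    where a path is required. *)
Definition linked A x y := exists p,
  [/\ path (@adj G) x p, last x p = y & [set` x :: p] `<=` A].

Lemma linked_refl A x : A x -> linked A x x.
Proof. by move=> Ax; exists [::]; split=> // z /=; rewrite inE => /eqP->. Qed.

Lemma linked_adj A x y : A x -> A y -> adj x y -> linked A x y.
Proof.
move=> Ax Ay xy; exists [:: y]; split=> [|//|z /=]; first by rewrite /= xy.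
by rewrite !inE => /orP[] /eqP->.
Qed.

Lemma linked_sym A x y : linked A x y -> linked A y x.
Proof.
move=> [p [pp py pA]]; exists (rev (belast x p)); split.
- rewrite -py rev_path; apply: sub_path pp => a b.
  by rewrite adj_sym.
- by case: p {pp pA} py => //= a p _; rewrite rev_cons last_rcons.
- move=> z /= zp; apply: pA => /=; move: zp.
  by rewrite -py inE mem_rev => zp; rewrite lastI mem_rcons inE.
Qed.

Lemma linked_trans A y x z : linked A x y -> linked A y z -> linked A x z.
Proof.
move=> [p [pp <- pA]] [q [qq <- qA]]; exists (p ++ q); split.
- by rewrite cat_path pp.
- by rewrite last_cat.
- move=> a /=; rewrite inE mem_cat orbA => /orP[ap|aq]; first exact: pA.
  by apply: qA => /=; rewrite inE aq orbT.
Qed.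

Lemma linked_sub A B x y : A `<=` B -> linked A x y -> linked B x y.
Proof. by move=> AB [p [? ? pA]]; exists p; split=> // z /pA/AB. Qed.

Lemma linked_left A x y : linked A x y -> A x.
Proof. by move=> [p [_ _ pA]]; apply: pA; rewrite /= mem_head. Qed.

Lemma linked_right A x y : linked A x y -> A y.
Proof. by move=> /linked_sym/linked_left. Qed.

Lemma linked_gpath A x y :
  linked A x y -> exists2 p, gpath x y p & [set` x :: p] `<=` A.
Proof.
move=> [p [pp py pA]]; case/shortenP: pp py => q qq uq qp qy.
exists q => // z /=; rewrite inE => /predU1P[->|/qp zp].
  by apply: pA; rewrite /= mem_head.
by apply: pA; rewrite /= inE zp orbT.
Qed.

Lemma gpath_linked A x y p :
  gpath x y p -> [set` x :: p] `<=` A -> linked A x y.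
Proof. by move=> [? _ ?] pA; exists p. Qed.

Lemma connected_linked A x y : connected_set A -> A x -> A y -> linked A x y.
Proof.
by move=> [_ Ac] Ax Ay; have [p /gpath_linked] := Ac _ _ Ax Ay; apply.
Qed.

Lemma linked_connected A x : A x -> (forall y, A y -> linked A x y) ->
  connected_set A.
Proof.
move=> Ax Ac; split; first by exists x.
move=> y z /Ac xy /Ac xz; apply: linked_gpath.
by apply: linked_trans xz; exact: linked_sym.
Qed.

(** Follow the walk up to the first edge that leaves [B]. *)
Lemma linked_exit A B x y : linked A x y -> B x -> ~ B y ->
  exists z w, [/\ linked (A `&` B) x z, A w, ~ B w & adj z w].
Proof.
move=> [p]; elim: p x => [|a p IHp] x [/= pp py pA] Bx By.
  by case: By; rewrite -py.
have Ax : A x by apply: pA; rewrite /= mem_head.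
have Aa : A a by apply: pA; rewrite /= !inE eqxx orbT.
case/andP: pp => xa pp; have [Ba|Ba] := pselect (B a); last first.
  by exists x, a; split=> //; exact: linked_refl.
have [|z [w [az Aw Bw zw]]] := IHp a _ Ba By.
  by split=> // z /= zp; apply: pA; rewrite /= inE zp orbT.
exists z, w; split=> //; apply: linked_trans az.
exact: linked_adj.
Qed.

Lemma linked_mem A x p w : path (@adj G) x p -> [set` x :: p] `<=` A ->
  w \in x :: p -> linked A x w.
Proof.
move=> pp pA wp; case/splitPl: wp pp pA => p1 p2 <-.
rewrite cat_path => /andP[pp1 _] pA.
exists p1; split=> // a /= ap; apply: pA => /=.
by move: ap; rewrite !inE mem_cat orbA => ->.
Qed.

Lemma connected_linked_set A x : A x -> connected_set [set y | linked A x y].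
Proof.
move=> Ax; split=> [|y z /= xy xz]; first by exists x; exact: linked_refl.
have /linked_gpath[p pP pA] : linked A y z.
  by apply: linked_trans xz; exact: linked_sym.
exists p => // w wp /=; apply: linked_trans xy _.
by have [pp _ _] := pP; exact: linked_mem pp pA wp.
Qed.

Lemma linked_component X x : x \notin X ->
  is_component X [set y | linked (~` [set` X]) x y].
Proof.
move=> /negP xX; split=> [y /linked_right//||B BX Bc xB].
  exact: connected_linked_set.
apply/seteqP; split=> // y By /=; apply: linked_sub BX _.
by apply: connected_linked => //; apply: xB; exact: linked_refl.
Qed.

Lemma component_linked X C x y : is_component X C -> C x ->
  C y <-> linked (~` [set` X]) x y.
Proof.
move=> [CX Cc Cmax] Cx.
have Cl z : C z -> linked (~` [set` X]) x z.
  by move=> Cz; apply: linked_sub CX _; exact: connected_linked.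
split=> [/Cl//|xy].
have <- // : [set z | linked (~` [set` X]) x z] = C.
apply: Cmax => [z /linked_right//||z /Cl//].
by apply: connected_linked_set; exact: CX.
Qed.

Lemma component_eq X C D x :
  is_component X C -> is_component X D -> C x -> D x -> C = D.
Proof.
move=> XC XD Cx Dx; apply/seteqP; split=> y.
  by move/(component_linked _ XC Cx)/(component_linked _ XD Dx).
by move/(component_linked _ XD Dx)/(component_linked _ XC Cx).
Qed.

End Linked.

(** * Directions, rays and convergent sequences *)

Section Directions.
Variable G : graph.
Implicit Types (A B L U W : set G) (X Y Z : {fset G}) (x y z : G).
Implicit Types (f h : {fset G} -> set G) (r s : nat -> G).

Lemma dir_nonempty f X : is_direction f -> f X !=set0.
Proof. by move=> [/(_ X)[_ []]]. Qed.

Lemma dir_notin f X x : is_direction f -> f X x -> x \notin X.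
Proof. by move=> [/(_ X)[fX _ _] _] /fX /negP. Qed.

Lemma dir_linked f X x y :
  is_direction f -> f X x -> f X y <-> linked (~` [set` X]) x y.
Proof. by move=> [fX _]; exact: component_linked. Qed.

Lemma dir_linked_in f X x y :
  is_direction f -> f X x -> f X y -> linked (f X) x y.
Proof. by move=> [/(_ X)[_ fc _] _]; exact: connected_linked. Qed.

Lemma dir_eq f h X x : is_direction f -> is_direction h ->
  f X x -> h X x -> f X = h X.
Proof. by move=> [fX _] [hX _]; exact: component_eq. Qed.

Lemma dir_anti f X Y : is_direction f -> (X `<=` Y)%fset -> f Y `<=` f X.
Proof. by move=> [_]; apply. Qed.

Lemma dir_meet f X Y : is_direction f -> exists2 x, f X x & f Y x.
Proof.
move=> fd; have [x fx] := dir_nonempty (X `|` Y)%fset fd.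
by exists x; apply: (dir_anti fd) fx; rewrite ?fsubsetUl ?fsubsetUr.
Qed.

(** [f X] is connected and meets [f Y], so avoiding [Y] keeps it inside that component. *)
Lemma dir_avoid_sub f X Y : is_direction f ->
  f X `<=` ~` [set` Y] -> f X `<=` f Y.
Proof.
move=> fd XY x fx; have [y Xy Yy] := dir_meet X Y fd.
apply/(dir_linked x fd Yy); apply: linked_sub XY _.
exact: dir_linked_in.
Qed.

Lemma dir_adj f X x y :
  is_direction f -> f X x -> adj x y -> y \notin X -> f X y.
Proof.
move=> fd fx xy /negP yX; apply/(dir_linked y fd fx); apply: linked_adj => //.
exact/negP/(dir_notin fd fx).
Qed.

(** Add [x] to [X]: the new region lies in [f X], and a walk in [f X] from there to [x] can leave it
    only by an edge to a deleted vertex outside [X], which is [x] itself. *)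
Lemma dir_greedy f X x : is_direction f -> f X x ->
  exists2 y, adj x y & f (x |` X)%fset y.
Proof.
move=> fd fx; have xX := fsubsetU1 x X.
have [y fy] := dir_nonempty (x |` X)%fset fd.
have yx : linked (f X) y x.
  by apply: dir_linked_in => //; exact: dir_anti xX _ fy.
have [|z [w [/linked_right[_ fz] fw wN zw]]] := linked_exit yx fy.
  by move=> /(dir_notin fd); rewrite !inE eqxx.
suff wx : w = x by exists z => //; rewrite -wx adj_sym.
apply: contrapT => wx; apply: wN; apply: dir_adj fz zw _ => //.
by rewrite !inE negb_or (dir_notin fd fw) andbT; apply/eqP.
Qed.

Lemma dir_ray f X : is_direction f -> exists2 r, is_ray r & range r `<=` f X.
Proof.
move=> fd.
have /choice[g gP] : forall p : {fset G} * G, exists y, f p.1 p.2 ->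
    adj p.2 y /\ f (p.2 |` p.1)%fset y.
  move=> [Y x] /=; have [fx|nfx] := pselect (f Y x); last by exists x.
  by have [y xy fy] := dir_greedy fd fx; exists y.
have [x0 fx0] := dir_nonempty X fd.
(* The state is the set deleted so far and the current vertex; each vertex is deleted when it is
   left, so none is repeated. *)
pose st n := iter n (fun p => ((p.2 |` p.1)%fset, g p)) (X, x0).
have stf n : f (st n).1 (st n).2.
  by elim: n => //= n IHn; have [] := gP _ IHn.
have stS m n : m <= n -> ((st m).1 `<=` (st n).1)%fset.
  elim: n => [|n IHn]; first by rewrite leqn0 => /eqP->.
  rewrite leq_eqVlt => /predU1P[->//|/IHn mn].
  by apply: fsubset_trans mn _; rewrite /= fsubsetU1.
have stlt m n : m < n -> (st m).2 <> (st n).2.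
  move=> mn mE; have := dir_notin fd (stf n); rewrite -mE => /negP; apply.
  by apply: (fsubsetP (stS _ _ mn)); rewrite /= !inE eqxx.
exists (fun n => (st n).2); first split=> [m n mn|n].
- by case: (ltngtP m n) => // /stlt; rewrite mn.
- by have [] := gP _ (stf n).
move=> _ [n _ <-]; apply: (dir_anti fd) (stf n).
exact: stS (leq0n n).
Qed.

(** Convergence to an end that is not named. As [linked] keeps both endpoints in its set, [s] also
    leaves every finite [X] eventually. *)
Definition eventually_linked s := forall X, exists N, forall n, N <= n ->
  linked (~` [set` X]) (s N) (s n).

(** For a convergent [s], the direction of its limit end. *)
Definition seq_dir s X : set G := [set y | exists N, forall n, N <= n ->
  linked (~` [set` X]) (s n) y].

Lemma seq_dir_tail s X : eventually_linked s ->
  exists N, forall n, N <= n -> seq_dir s X (s n).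
Proof.
move=> /(_ X)[N sN]; exists N => n Nn; exists N => m Nm.
by apply: linked_trans (sN n Nn); apply: linked_sym; exact: sN.
Qed.

Lemma seq_dirP s : eventually_linked s -> is_direction (seq_dir s).
Proof.
move=> sl; split=> [X|X Y XY y [N sN]]; last first.
  exists N => n /sN; apply: linked_sub => z /= zY zX; apply: zY.
  exact: (fsubsetP XY).
have [N sN] := sl X.
suff -> : seq_dir s X = [set y | linked (~` [set` X]) (s N) y].
  by apply: linked_component; apply/negP; exact: linked_left (sN N (leqnn N)).
apply/seteqP; split=> y /=.
  move=> [M sM]; apply: linked_trans (sM (maxn M N) (leq_maxl _ _)).
  by apply: sN; exact: leq_maxr.
move=> Ny; exists N => n Nn; apply: linked_trans Ny.
by apply: linked_sym; exact: sN.
Qed.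

Lemma seq_dir_eq f s X : is_direction f -> eventually_linked s ->
  (exists N, forall n, N <= n -> f X (s n)) -> seq_dir s X = f X.
Proof.
move=> fd sl [N fN]; have [M sM] := seq_dir_tail X sl.
apply: (@dir_eq _ _ _ (s (maxn M N))) => //; first exact: seq_dirP.
  by apply: sM; exact: leq_maxl.
by apply: fN; exact: leq_maxr.
Qed.

Lemma inj_eventually_notin s X : injective s ->
  exists N, forall n, N <= n -> s n \notin X.
Proof.
move=> sI.
suff [N sN] : exists N, forall n, N <= n -> s n \notin enum_fset X by exists N.
elim: (enum_fset X) => [|x t [N sN]]; first by exists 0.
have [[m <-]|xs] := pselect (exists m, s m = x).
  exists (maxn m.+1 N) => n; rewrite geq_max inE => /andP[mn /sN/negPf->].
  by rewrite orbF; apply/eqP => /sI nm; rewrite nm ltnn in mn.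
exists N => n /sN/negPf; rewrite inE => ->; rewrite orbF.
by apply/eqP => sx; apply: xs; exists n.
Qed.

Lemma ray_eventually_linked r : is_ray r -> eventually_linked r.
Proof.
move=> [rI ra] X; have [N rN] := inj_eventually_notin X rI.
exists N => n; elim: n => [|n IHn].
  rewrite leqn0 => /eqP N0; rewrite N0; apply: linked_refl.
  by apply/negP/rN; rewrite N0.
rewrite leq_eqVlt => /predU1P[<-|Nn].
  by apply: linked_refl; apply/negP/rN.
apply: linked_trans (IHn Nn) _; apply: linked_adj => //; apply/negP/rN => //.
exact: leqW.
Qed.

Definition ray_class (r : nat -> G) : set (nat -> G) :=
  [set s | is_ray s /\ ray_equiv r s].

Lemma ray_equiv_refl r : is_ray r -> ray_equiv r r.
Proof.
move=> [rI _] X; have [N rN] := inj_eventually_notin X rI.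
move=> /(_ (r N) (r N) [::]) [|||z] //.
by rewrite inE => /eqP->; apply/negP/rN.
Qed.

Lemma ray_class_direction r :
  is_ray r -> end_direction (ray_class r) (seq_dir r).
Proof.
move=> rr X s [sr rs].
have rl := ray_eventually_linked rr; have sl := ray_eventually_linked sr.
have [M rM] := seq_dir_tail X rl; have [N sN] := sl X.
(* Deleting also the first [M] vertices of [r] and the first [N] of [s] forces the connecting path
   to join two tails, each of which stays in one component of [G - X]. *)
pose Y := (X `|` [fset r i | i in iota 0 M]
  `|` [fset s i | i in iota 0 N])%fset.
have /existsNP[x /existsNP[y /existsNP[p]]] := rs Y.
move=> /not_implyP[[i _ xE]] /not_implyP[[j _ yE]] /not_implyP[xyp].
move=> /forall2NP pY.
have pYC : [set` x :: p] `<=` ~` [set` Y].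
  by move=> z zp; case: (pY z).
have xy := gpath_linked xyp pYC.
have XY : (X `<=` Y)%fset by rewrite /Y -fsetUA fsubsetUl.
have xy' : linked (~` [set` X]) x y.
  by apply: linked_sub xy => z /= zY zX; apply: zY; apply: (fsubsetP XY).
have Mi : M <= i.
  rewrite leqNgt; apply/negP => iM; apply: (linked_left xy).
  by rewrite /= !inE -xE in_imfset ?orbT //= mem_iota.
have Nj : N <= j.
  rewrite leqNgt; apply/negP => jN; apply: (linked_right xy).
  by rewrite /= !inE -yE [X in _ || X]in_imfset ?orbT //= mem_iota.
have rd := seq_dirP rl.
exists N => m Nm; apply/(dir_linked _ rd (rM i Mi)); rewrite xE.
apply: linked_trans xy' _; rewrite -yE.
by apply: linked_trans (sN m Nm); apply: linked_sym; exact: sN.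
Qed.

End Directions.

(** * The countable chain condition and countable determination *)

Section CountableChain.
Variable G : graph.
Implicit Types (A B L U W : set G) (X Y Z : {fset G}) (x y z : G).
Implicit Types (f h : {fset G} -> set G).

(** In such a [U] it is enough to delete subsets of [U]: vertices of [U] linked off the trace of a
    finite [X] on [U] are linked off all of [X]. *)
Definition path_closed U := forall x y Y, U x -> U y -> [set` Y] `<=` U ->
  linked (~` [set` Y]) x y -> linked (U `\` [set` Y]) x y.

Lemma path_closure W : countable W ->
  exists U, [/\ countable U, W `<=` U & path_closed U].
Proof.
move=> cW.
have /choice[p pP] : forall t : G * G * {fset G}, exists p : seq G,
    linked (~` [set` t.2]) t.1.1 t.1.2 ->
    [/\ path (@adj G) t.1.1 p, last t.1.1 p = t.1.2 &
        [set` t.1.1 :: p] `<=` ~` [set` t.2]].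
  move=> t; have [[p tp]|nt] := pselect (linked (~` [set` t.2]) t.1.1 t.1.2).
    by exists p.
  by exists [::].
pose e Y := W `|` \bigcup_(t in ([set` Y] `*` [set` Y]) `*`
  [set Z : {fset G} | [set` Z] `<=` [set` Y]]) [set` t.1.1 :: p t].
have [|U cU eU] := @countable_closure _ e.
  move=> Y; apply: (countable_setU cW); apply: bigcup_countable => [|t _].
    by apply: countableX (countable_fsubsets _) => //; exact: countableX.
  exact/finite_set_countable/finite_seq.
exists U; split=> // [x Wx|x y Y Ux Uy YU xy].
  by apply: (eU fset0) => [y|]; [rewrite /= inE|left].
have [/= pp py pY] := pP (x, y, Y) xy.
exists (p (x, y, Y)); split=> // z zp; split; last exact: pY.
apply: (eU (x |` (y |` Y))%fset) => [w|].
  by rewrite /= !inE => /or3P[/eqP->|/eqP->|/YU].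
right; exists (x, y, Y) => //=.
by split=> [|w /= wY]; [split|]; rewrite /= !inE ?wY ?eqxx ?orbT.
Qed.

Definition dir_region L := exists f X, is_direction f /\ f X = L.

Definition far_apart A B := forall x y, A x -> B y -> x <> y /\ ~~ adj x y.

(* The countable chain condition for the end space of [G]. *)
Definition dir_ccc := forall F : set (set G), F `<=` dir_region ->
  (forall A B, F A -> F B -> A <> B -> far_apart A B) -> countable F.

Lemma far_apart_sym A B : far_apart A B -> far_apart B A.
Proof.
move=> AB x y Bx Ay; have [yx] := AB y x Ay Bx.
by rewrite adj_sym; split=> // xy; apply: yx.
Qed.

(** Meeting the component [f X] or sending an edge to it puts a vertex of [L] into it, and
    connectedness then draws in all of [L]. *)
Lemma not_far_sub f X L : is_direction f -> connected_set L ->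
  L `<=` ~` [set` X] -> ~ far_apart L (f X) -> L `<=` f X.
Proof.
move=> fd Lc LX nLf.
suff [x Lx fx] : exists2 x, L x & f X x.
  move=> y Ly; apply/(dir_linked y fd fx).
  by apply: linked_sub LX _; exact: connected_linked.
apply: contrapT => /forall2NP Lf; apply: nLf => x y Lx fy; split=> [xy|].
  by have [] := Lf y; rewrite -?xy //; move: fy; rewrite -xy.
apply/negP => xy; have [//|] := Lf x; apply.
by apply: dir_adj fy _ _ => //; [rewrite adj_sym|exact/negP/LX].
Qed.

Lemma dir_components_far f h X : is_direction f -> is_direction h ->
  f X <> h X -> far_apart (f X) (h X).
Proof.
move=> fd hd fh x y fx hy; split=> [xy|].
  by apply: fh; apply: (dir_eq fd hd fx); rewrite xy.
apply/negP => xy; apply: fh; apply: (dir_eq fd hd fx).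
by apply: (dir_adj hd hy); [rewrite adj_sym|exact: (dir_notin fd fx)].
Qed.

(** Distinct components of [G - X] are far apart. *)
Lemma dir_ccc_countable_regions X : dir_ccc ->
  countable [set L | exists2 f, is_direction f & f X = L].
Proof.
move=> ccc; apply: ccc => [L [f fd fL]|A B [f fd <-] [h hd <-]].
  by exists f, X.
exact: dir_components_far.
Qed.

(* Pressing down a choice of regions [f_U Z_U] missing [U] makes
   [F = Z_U `&` U] constant for stationarily many [U].  If such a [U] absorbs
   maximal far-apart families of these regions, then every vertex of [U] next to
   the component of [G - U] containing [f_U Z_U] lies in [F].  So [f_U F] would
   miss [U], although [U] can be taken to meet the countably many regions with
   finite set [F]. *)
Lemma dir_ccc_dense : dir_ccc -> exists2 U, countable U &
  forall f Z, is_direction f -> exists2 x, f Z x & U x.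
Proof.
move=> ccc.
have [[f0 fd0]|nod] := pselect (exists f, is_direction f); last first.
  by exists set0 => // f Z fd; case: nod; exists f.
apply: contrapT => /forall2NP noU.
have {noU} /choice[c cP] : forall U, exists c : ({fset G} -> set G) * {fset G},
    is_direction c.1 /\ (countable U -> c.1 c.2 `<=` ~` U).
  move=> U; have [cU|nU] := pselect (countable U); last first.
    by exists (f0, fset0); split=> // /nU.
  have [//|/existsNP[f /existsNP[Z /not_implyP[fd /forall2NP fU]]]] := noU U.
  by exists (f, Z); split=> // _ x fx Ux; have [] := fU x.
pose f U := (c U).1; pose Z U := (c U).2; pose L U := f U (Z U).
have fd U : is_direction (f U) by exact: (cP U).1.
have LU U : countable U -> L U `<=` ~` U by exact: (cP U).2.
have Lreg U : dir_region (L U) by exists (f U), (Z U).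
have Lc U : connected_set (L U) by have [/(_ (Z U))[]] := fd U.
have [|F statF] :=
    @pressing_down _ (fun U => [fset z in Z U | `[< U z >]]%fset).
  by move=> U _ z /=; rewrite !inE => /andP[_ /asboolP].
pose S Y := [set U | [/\ countable U, [set` Y] `<=` U &
  [fset z in Z U | `[< U z >]]%fset = F]].
have /choice[M MP] : forall Y, exists M, [/\ M `<=` S Y,
    forall U W, M U -> M W -> U <> W -> far_apart (L U) (L W) &
    forall U, S Y U -> M U \/ exists2 W, M W & ~ far_apart (L U) (L W)].
  move=> Y; apply: (@maximal_pairwise _ (fun U W => far_apart (L U) (L W))).
  by move=> U W; exact: far_apart_sym.
have cM Y : countable (M Y).
  have [MS Mfar _] := MP Y.
  have Linj U W : M Y U -> M Y W -> L U = L W -> U = W.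
    move=> MU MW UW; apply: contrapT => /(Mfar _ _ MU MW) far.
    have [x Lx] := dir_nonempty (Z U) (fd U).
    have Wx : L W x by rewrite -UW.
    by have [] := far x x Lx Wx.
  apply: (countable_inj (h := L) (B := L @` M Y)) => //.
  apply: ccc => [_ [U _ <-]//|_ _ [U MU <-] [W MW <-] UW].
  by apply: Mfar => // UW'; rewrite UW' in UW.
pose R := [set K | exists2 h, is_direction h & h F = K].
have /choice[w wP] : forall K, exists x, R K -> K x.
  move=> K; have [[h hd <-]|nK] := pselect (R K).
    by have [x] := dir_nonempty F hd; exists x.
  have [x _] := dir_nonempty fset0 (fd set0).
  by exists x.
(* A set closed under [e] contains a vertex of every region with finite set [F] and, for each of its
   finite subsets [Y], all members of [M Y] along with their finite sets. *)
pose e Y := (w @` R) `|` \bigcup_(U in M Y) (U `|` [set` Z U]).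
have [Y|U [cU eU FU]] := statF e.
  apply: countable_setU.
    apply: sub_countable (card_image_le _ _) _.
    exact: dir_ccc_countable_regions.
  apply: bigcup_countable => // V MV; have [MS _ _] := MP Y.
  have [cV _ _] := MS _ MV.
  exact: countable_setU.
have FZU x : x \in F <-> x \in Z U /\ U x.
  rewrite -FU !inE; split=> [/andP[-> /asboolP]|[-> /asboolP]] //.
have [x Lx fx] : exists2 x, L U x & f U F x.
  have [x Lx] := dir_nonempty (Z U) (fd U); exists x => //.
  by apply: (dir_anti (fd U)) Lx; apply/fsubsetP => z /FZU[].
have RfU : R (f U F) by exists (f U).
have Uw : U (w (f U F)).
  by apply: (eU fset0) => [z|]; [rewrite /= inE|left; exists (f U F)].
have xw := dir_linked_in (fd U) fx (wP _ RfU).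
(* The walk runs inside [f U F] from [L U], outside [U], to a vertex of [U]; [vu] is its first edge
   entering [U]. The aim is to show that [u] lies in [F], which [f U F] avoids. *)
have [|v [u [xv fu /contrapT Uu vu]]] :=
    linked_exit (B := ~` U) xw (LU _ cU _ Lx).
  by move=> /(_ Uw).
suff : u \in F by apply/negP/(dir_notin (fd U) fu).
have uU : [set` [fset u]] `<=` U by move=> z /=; rewrite inE => /eqP->.
have Su : S [fset u] U by [].
have [MS _ Mmax] := MP [fset u].
have MU_U W : M [fset u] W -> W `<=` U /\ [set` Z W] `<=` U.
  by move=> MW; split=> z Wz; apply: (eU _ uU); right; exists W => //;
    [left|right].
(* Unless [U] itself is a member, maximality yields a member [W] whose region is not far from [L U].
   As [L U] misses [U], it misses [Z W] and falls inside [L W]. *)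
have [W MW LUW] : exists2 W, M [fset u] W & L U `<=` L W.
  have [MU|[W MW UW]] := Mmax U Su; first by exists U.
  exists W => //; apply: (not_far_sub (fd W)) => // z Lz Zz.
  by apply: (LU _ cU _ Lz); apply: (MU_U W MW).2.
have [WU ZWU] := MU_U W MW; have [cW uW FW] := MS _ MW.
have Wu : W u by apply: uW; rewrite /= inE.
rewrite -FW !inE; apply/andP; split; last exact/asboolP.
apply: contrapT => /negP uZ; apply: (LU _ cW u) => //.
(* The walk to [v] avoids [U], hence [Z W]. So the neighbour [u] of [v] would lie in [L W] if it
   were not in [Z W], but [u] is in [W], which [L W] misses. *)
have Lv : L W v.
  apply/(dir_linked v (fd W) (LUW _ Lx)).
  by apply: linked_sub xv => z [_ nUz] /ZWU.
exact: (dir_adj (fd W) Lv).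
Qed.

(** Let [U] be path-closed and meet every region. If two directions differ at [Z], they differ at
    the trace of [Z] on [U]: otherwise vertices of [U] in the two regions would be linked off [Z].
    Each finite set carries only countably many choices. *)
Lemma dir_ccc_countably_determined : dir_ccc -> countably_determined G.
Proof.
move=> ccc; have [U0 cU0 U0P] := dir_ccc_dense ccc.
have [U [cU U0U Upc]] := path_closure cU0.
exists [set d | [set` d.1] `<=` U /\ exists2 f, is_direction f & f d.1 = d.2].
split=> [|[X C] /= [_ [f [fd _] <-]]|f h fd hd fh].
- apply: (@countable_subset _ _ ([set Y : {fset G} | [set` Y] `<=` U] `*``
    (fun X => [set L | exists2 f, is_direction f & f X = L]))).
    by move=> [X C].
  apply: countableXR => [|X _]; first exact: countable_fsubsets.
  exact: dir_ccc_countable_regions.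
- exact: fd.
have [Z fhZ] : exists Z, f Z <> h Z.
  apply: contrapT => /forallNP fh'; apply/fh/funext => Z.
  by apply: contrapT; exact: fh'.
pose Y := [fset z in Z | `[< U z >]]%fset.
have YU : [set` Y] `<=` U by move=> z /=; rewrite !inE => /andP[_ /asboolP].
have YZ : (Y `<=` Z)%fset by apply/fsubsetP => z; rewrite !inE => /andP[].
exists (Y, f Y); first by split=> //; exists f.
split=> //= hfY; apply: fhZ.
have [u fu /U0U Uu] := U0P f Z fd; have [v hv /U0U Uv] := U0P h Z hd.
have uv : linked (~` [set` Y]) u v.
  apply/(dir_linked v fd (dir_anti fd YZ fu)); rewrite -hfY.
  exact: (dir_anti hd YZ hv).
apply: (dir_eq fd hd _ hv); apply/(dir_linked v fd fu).
apply: linked_sub (Upc _ _ _ Uu Uv YU uv) => z [Uz zY] zZ.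
by apply: zY; rewrite /= !inE; apply/andP; split=> //; exact/asboolP.
Qed.

Lemma countable_fset_chain U : countable U ->
  exists Y : nat -> {fset G}, [/\ forall n, [set` Y n] `<=` U,
    forall n, (Y n `<=` Y n.+1)%fset &
    forall X, [set` X] `<=` U -> exists n, (X `<=` Y n)%fset].
Proof.
move=> /countable_injP[g gI].
have /choice[Y YP] : forall n, exists Y : {fset G},
    forall x, x \in Y <-> U x /\ g x < n.
  elim=> [|n [Y YP]].
    by exists fset0 => x; rewrite inE ltn0; split=> [|[]].
  have [[a [Ua ga]]|na] := pselect (exists a, U a /\ g a = n).
    exists (a |` Y)%fset => x; rewrite !inE ltnS leq_eqVlt; split.
      by case/predU1P=> [->|/YP[Ux ->]]; rewrite ?orbT // ga eqxx.
    move=> [Ux /predU1P[xn|xn]]; last by apply/orP; right; apply/YP.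
    by rewrite (gI x a) ?eqxx ?inE // ga.
  exists Y => x; rewrite YP ltnS (leq_eqVlt (g x)).
  split=> [[Ux ->]|]; first by rewrite orbT.
  by move=> [Ux /predU1P[xn|//]]; case: na; exists x.
exists Y; split=> [n x /YP[]//|n|X XU].
  by apply/fsubsetP => x /YP[Ux xn]; apply/YP; split=> //; exact: leqW.
exists (\max_(x <- enum_fset X) g x).+1; apply/fsubsetP => x xX; apply/YP.
by split; [exact: XU|rewrite ltnS; exact: leq_bigmax_seq].
Qed.

(** [h] is the limit of vertices of [U] chosen in [f (Y n)] along a cofinal chain of finite subsets
    [Y n] of [U]; path-closedness gives the convergence. *)
Lemma path_closed_direction f U : is_direction f -> countable U ->
  path_closed U -> (forall Y, [set` Y] `<=` U -> exists2 x, f Y x & U x) ->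
  exists h, [/\ is_direction h, forall Y, [set` Y] `<=` U -> h Y = f Y &
    forall Z, exists2 x, h Z x & U x].
Proof.
move=> fd cU Upc fU; have [Y [YU Yinc Ycof]] := countable_fset_chain cU.
have /choice[s sP] : forall n, exists x, f (Y n) x /\ U x.
  by move=> n; have [x fx Ux] := fU _ (YU n); exists x.
have Yle m n : m <= n -> (Y m `<=` Y n)%fset.
  elim: n => [|n IHn]; first by rewrite leqn0 => /eqP->.
  rewrite leq_eqVlt => /predU1P[->//|/IHn mn].
  exact: fsubset_trans mn (Yinc n).
have sf m n : m <= n -> f (Y m) (s n).
  by move=> /Yle mn; apply: (dir_anti fd mn); exact: (sP n).1.
have sl : eventually_linked s.
  move=> X; have [|N XN] := Ycof [fset z in X | `[< U z >]]%fset.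
    by move=> z /=; rewrite !inE => /andP[_ /asboolP].
  exists N => n Nn.
  have Nl : linked (~` [set` Y N]) (s N) (s n).
    by apply/(dir_linked _ fd (sf N N (leqnn N))); exact: sf.
  apply: linked_sub (Upc _ _ _ (sP N).2 (sP n).2 (YU N) Nl) => z [Uz zY] zX.
  apply: zY; apply: (fsubsetP XN); rewrite !inE; apply/andP; split=> //.
  exact/asboolP.
exists (seq_dir s); split=> [|X XU|Z].
- exact: seq_dirP.
- have [N XN] := Ycof X XU; apply: seq_dir_eq => //; exists N => n Nn.
  by apply: (dir_anti fd XN); exact: sf.
have [N sN] := seq_dir_tail Z sl.
by exists (s N); [exact: sN|exact: (sP N).2].
Qed.

Lemma countably_determined_dir_ccc : countably_determined G -> dir_ccc.
Proof.
move=> [D [cD Dch Ddist]] F Freg Ffar.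
have [|U [cU DU Upc]] := @path_closure (\bigcup_(d in D) [set` d.1]).
  by apply: bigcup_countable => // d _; exact: countable_fset.
have Fdisj A B x : F A -> F B -> A x -> B x -> A = B.
  move=> FA FB Ax Bx; apply: contrapT => AB.
  by have [] := Ffar _ _ FA FB AB x x Ax Bx.
(* Members of [F] are pairwise disjoint, so only countably many meet [U]; those missing [U]
   remain. *)
pose FF := [set L | F L /\ L `<=` ~` U].
suff cF : countable FF.
  have cFU : countable [set L | F L /\ exists2 x, L x & U x].
    apply: (@countable_subset _ _ (\bigcup_(u in U) [set L | F L /\ L u])).
      by move=> L [FL [u Lu Uu]]; exists u.
    apply: bigcup_countable => // u _.
    apply: (countable_inj (h := fun=> tt) (B := [set: unit])) => // A B.
    by move=> [FA Au] [FB Bu] _; exact: Fdisj Au Bu.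
  apply: (countable_subset (B := FF `|` [set L | F L /\ exists2 x, L x & U x])).
    move=> L FL; have [LU|LU] := pselect (exists2 x, L x & U x); first by right.
    by left; split=> // x Lx Ux; apply: LU; exists x.
  exact: countable_setU.
have /choice[c cP] : forall L : set G,
    exists c : ({fset G} -> set G) * {fset G}, F L /\ L `<=` ~` U ->
    [/\ is_direction c.1, [set` c.2] `<=` U, c.1 c.2 `<=` ~` U &
      exists Z, c.1 Z = L].
  move=> L; have [[FL LU]|nL] := pselect (F L /\ L `<=` ~` U); last first.
    by exists (fun _ => set0, fset0) => /nL.
  have [f [Z [fd fZ]]] := Freg _ FL.
  (* Otherwise some direction [h] agrees with [f] on all finite subsets of [U], hence on every
     choice in [D], yet differs from [f] because [L] misses [U]. *)
  suff [Y YU fY] : exists2 Y : {fset G}, [set` Y] `<=` U & f Y `<=` ~` U.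
    by exists (f, Y) => _; split=> //; exists Z.
  apply: contrapT => /forall2NP nY.
  have [|h [hd hf hU]] := path_closed_direction fd cU Upc.
    move=> Y YU; have [//|/existsNP[x /not_implyP[fx /contrapT Ux]]] := nY Y.
    by exists x.
  have fh : f <> h.
    move=> fh; have [x hx Ux] := hU Z; apply: (LU x) => //.
    by rewrite -fZ fh.
  have [d Dd [fd1 hd1]] := Ddist _ _ fd hd fh.
  apply: hd1; rewrite hf // => x dx; by apply: DU; exists d.
pose f L := (c L).1; pose Y L := (c L).2; pose K L := f L (Y L).
(* For [L] in [FF] this is the whole neighbourhood of [K L], a component of [G - Y L]. *)
pose N L := [fset y in Y L | `[< exists2 x, K L x & adj y x >]]%fset.
(* [d.1] lies in [U], so [K L], which misses [U], is contained in the component [d.2], while [f M]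
   picks another component. *)
have Kdist L M : FF L -> FF M -> L <> M -> exists2 d, D d &
    [/\ f L d.1 = d.2, K L `<=` d.2 & forall x, f M d.1 x -> ~ d.2 x].
  move=> FL FM LM.
  have [fd YU KU [Z fZ]] := cP L FL; have [gd XU MU [Z' gZ]] := cP M FM.
  have [|d Dd [fd1 gd1]] := Ddist _ _ fd gd.
    move=> fg; have [x fx] := dir_nonempty (Z `|` Z')%fset fd.
    apply: LM; apply: (Fdisj _ _ x FL.1 FM.1).
      by rewrite -fZ; apply: (dir_anti fd _ fx); exact: fsubsetUl.
    by rewrite -gZ -fg; apply: (dir_anti fd _ fx); exact: fsubsetUr.
  have dU : [set` d.1] `<=` U by move=> x dx; apply: DU; exists d.
  exists d => //; split=> [//||x gx]; rewrite -fd1.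
    by apply: dir_avoid_sub => // x /KU Ux /dU.
  by move=> fx; apply: gd1; rewrite -fd1; exact: (dir_eq gd fd gx).
have Kne L : FF L -> exists x, K L x.
  by move=> /cP[fd _ _ _]; exact: (dir_nonempty (Y L) fd).
have Ksub L M d : FF M -> D d -> K M `<=` f M d.1.
  move=> FM Dd; have [gd XU MU _] := cP M FM.
  by apply: dir_avoid_sub => // x /MU Ux dx; apply/Ux/DU; exists d.
have KI L M : FF L -> FF M -> K L = K M -> L = M.
  move=> FL FM KLM; apply: contrapT => /(Kdist _ _ FL FM)[d Dd [_ Kd MK]].
  have [x Kx] := Kne L FL; apply: (MK x); last exact: Kd.
  by apply: Ksub => //; rewrite -KLM.
(* If [d.2] were larger than [K L], it would contain some [w] in [N L]. As [N L = N M], this [w] is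
   next to [K M], hence in [f M d.1], which is disjoint from [d.2]. *)
have NI L M : FF L -> FF M -> L <> M -> N L = N M -> (snd @` D) (K L).
  move=> FL FM LM NLM; have [d Dd [fLd Kd MK]] := Kdist L M FL FM LM.
  exists d => //; apply/seteqP; split=> // y dy; apply: contrapT => Ky.
  have [fd _ KU _] := cP L FL; have [gd _ _ _] := cP M FM.
  rewrite -/(f L) in fd; have [x Kx] := Kne L FL.
  have xy : linked d.2 x y.
    by rewrite -fLd; apply: dir_linked_in => //; rewrite fLd //; exact: Kd.
  have [z [w [/linked_right[_ Kz] dw Kw zw]]] := linked_exit xy Kx Ky.
  have : w \in N M.
    rewrite -NLM !inE; apply/andP; split.
      by apply: contrapT => /negP wY; apply: Kw; exact: dir_adj Kz zw wY.
    by apply/asboolP; exists z => //; rewrite adj_sym.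
  rewrite !inE => /andP[_ /asboolP[v Kv wv]].
  apply: (MK w) => //; apply: (@dir_adj _ _ _ v) => //.
  - exact: Ksub Kv.
  - by rewrite adj_sym.
  - by apply: (dir_notin fd); rewrite fLd.
(* Where [K L] occurs in [D], count by [K L]; on the remaining regions [N] is injective, with finite
   subsets of [U] as values. *)
apply: (countable_subset (B := [set L | FF L /\ (snd @` D) (K L)] `|`
    [set L | FF L /\ ~ (snd @` D) (K L)])).
  move=> L FL.
  by have [KD|KD] := pselect ((snd @` D) (K L)); [left|right].
apply: countable_setU.
  apply: (countable_inj (h := K) (B := snd @` D)).
  - by move=> L M [FL _] [FM _]; exact: KI.
  - by move=> L [].
  - exact: sub_countable (card_image_le _ _) cD.
apply: (countable_inj (h := N) (B := [set X : {fset G} | [set` X] `<=` U])).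
- move=> L M [FL KL] [FM _] NLM; apply: contrapT => LM.
  by apply: KL; exact: NI NLM.
- move=> L [FL _] y /=; rewrite !inE => /andP[yY _].
  by have [_ YU _ _] := cP L FL; exact: YU.
- exact: countable_fsubsets.
Qed.

End CountableChain.

(** * Stars as trees, and their paths *)

Section Stars.
Variables (T : graph) (c : T).

Lemma star_adj_center (t : T) : is_star c -> t <> c -> adj t c.
Proof. by move=> cstar /eqP/negPf tc; rewrite cstar tc eqxx. Qed.

Lemma star_gpath (t s : T) : is_star c ->
  t <> c -> s <> c -> t <> s -> gpath t s [:: c; s].
Proof.
move=> cstar tc sc /eqP ts; split=> //=.
  by rewrite star_adj_center // adj_sym star_adj_center.
move/eqP/negPf: tc => tc; move/eqP/negPf: sc => sc.
by rewrite !inE negb_or ts tc eq_sym sc.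
Qed.

Lemma star_adj_leaf (t s : T) : is_star c -> t <> c -> adj t s -> s = c.
Proof. by move=> cstar /eqP/negPf tc; rewrite cstar tc => /eqP. Qed.

(** Every edge contains [c], so a cycle of length at least three would visit [c] twice. *)
Lemma star_is_tree : is_star c -> is_tree T.
Proof.
move=> cstar; split=> [|s]; last first.
  case: s => [|x [|y [|z s]]] // _ /andP[].
  rewrite /cycle rcons_path => /andP[/and3P[xy yz _] lx].
  move=> /and3P[xN yN _]; have [yc|yc] := pselect (y = c).
    have lc : last x [:: y, z & s] = c.
      apply: (@star_adj_leaf x) => //; last by rewrite adj_sym.
      by move=> xc; move: xN; rewrite inE xc yc eqxx.
    by move: yN; rewrite yc -lc /= mem_last.
  have zc := star_adj_leaf cstar yc yz.
  have xc : x = c by apply: star_adj_leaf cstar yc _; rewrite adj_sym.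
  by move: xN; rewrite xc zc !inE eqxx orbT.
have lc (t : T) : linked [set: T] t c.
  have [->|tc] := pselect (t = c); first exact: linked_refl.
  by apply: linked_adj => //; exact: star_adj_center.
split=> [|x y _ _]; first by exists c.
by apply: linked_gpath; apply: linked_trans (lc x) _; exact: linked_sym.
Qed.

(** An inner vertex other than [c] would have [c] on both sides, and a path with equal ends is
    trivial. *)
Lemma star_gpath_inner (t1 t2 t3 : T) p : is_star c ->
  gpath t1 t3 p -> t2 \in t1 :: p -> t1 <> t2 -> t3 <> t2 -> t2 = c /\ t1 <> t3.
Proof.
move=> cstar [pp pU pl] t2p t12 t32; split; last first.
  move=> t13; move: t2p pU pl; rewrite inE => /predU1P[/esym//|].
  case/lastP: p pp => // q x _ _ /= /andP[+ _]; rewrite last_rcons => + xE.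
  by rewrite xE t13 mem_rcons mem_head.
apply: contrapT => t2c; move: t2p; rewrite inE => /predU1P[/esym//|t2p].
case/splitPr: t2p pp pU pl => p1 [|a p2].
  by rewrite last_cat /= => _ _ /esym.
rewrite cat_path => /andP[_ /and3P[t2l t2a _]].
have ac := star_adj_leaf cstar t2c t2a.
have lc : last t1 p1 = c by apply: star_adj_leaf cstar t2c _; rewrite adj_sym.
rewrite -cat_cons cat_uniq => /and3P[_ /negP + _] _; apply; apply/hasP.
exists a; first by rewrite !inE eqxx orbT.
by rewrite /= ac -lc; exact: mem_last.
Qed.

End Stars.

(** * Star-decompositions and far-apart regions *)

Section StarDecompositions.
Variable G : graph.

(** Deleting the finite adhesion set of a leaf [t] confines a direction living there to [V t] minus
    [V c]; such regions of different leaves are far apart. *)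
Lemma star_decomposition_not_dir_ccc (T : graph) (V : T -> set G) (c : T) :
  uncountable_star_decomposition V c -> finite_adhesion V ->
  (forall t : T, t <> c ->
    exists2 f, is_direction f & direction_lives_in V f t) ->
  ~ dir_ccc G.
Proof.
move=> [[_ _ Vedge Vpath] cstar nct] Vfin Vdir ccc; apply: nct.
have VV t s x : t <> c -> s <> c -> t <> s -> V t x -> V s x -> V c x.
  move=> tc sc ts tx sx.
  apply: (Vpath t c s _ (star_gpath cstar tc sc ts)) => //.
  by rewrite !inE eqxx orbT.
have Vadj t x y : t <> c -> V t x -> ~ V c x -> adj x y -> V t y.
  move=> tc tx ncx /Vedge[s [sx sy]].
  have [<-//|st] := pselect (s = t); case: ncx.
  have [<-//|sc] := pselect (s = c).
  exact: (VV s t).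
have /choice[L LP] : forall t : T, exists L, t <> c ->
    dir_region L /\ L `<=` V t `\` V c.
  move=> t; have [->|tc] := pselect (t = c); first by exists set0.
  have [f fd [w [_ wf [r wr rinf]]]] := Vdir t tc.
  have /finite_fsetP[X XE] : finite_set (V t `&` V c).
    by apply: Vfin; exact: star_adj_center.
  have Xc x : f X x -> V t x -> ~ V c x.
    move=> /(dir_notin fd) xX tx cx; move/negP: xX; apply.
    by have : (V t `&` V c) x by []; rewrite XE.
  exists (f X) => _; split; first by exists f, X.
  have [n rn] := wf X r wr.
  (* Only finitely many vertices of [r] lie outside [f X], and infinitely many lie in [V t]. *)
  have [x fx tx] : exists2 x, f X x & V t x.
    apply: contrapT => /forall2NP nx; apply: rinf.
    apply: sub_finite_set (finite_image r (finite_II n)).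
    move=> _ [[m _ <-] tm]; exists m => //=; rewrite ltnNge; apply/negP => nm.
    by have [|] := nx (r m); [apply; exact: rn|].
  suff ft y : f X y -> V t y by move=> y fy; split; [exact: ft|exact/Xc/ft].
  move=> fy; apply: contrapT => nty.
  have [z [w' [/linked_right[fz tz] _ nw zw]]] :=
    linked_exit (dir_linked_in fd fx fy) tx nty.
  by apply: nw; apply: Vadj zw => //; exact: Xc.
have Lne t : t <> c -> exists x, L t x.
  by move=> /LP[[f [X [fd <-]]] _]; exact: dir_nonempty X fd.
have Lfar t s : t <> c -> s <> c -> t <> s -> far_apart (L t) (L s).
  move=> tc sc ts x y /(LP t tc).2[tx cx] /(LP s sc).2[sy cy]; split=> [xy|].
    by apply: cx; apply: (VV t s) => //; rewrite xy.
  apply/negP => xy; apply: cy; apply: (VV t s) => //.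
  exact: Vadj tx cx xy.
have LI t s : t <> c -> s <> c -> L t = L s -> t = s.
  move=> tc sc Lts; apply: contrapT => ts; have [x Lx] := Lne t tc.
  by have [|] := Lfar t s tc sc ts x x Lx _; first by rewrite -Lts.
apply: (countable_inj (h := L) (B := L @` [set~ c])) => //.
apply: ccc => [_ [t tc <-]|_ _ [t tc <-] [s sc <-] Lts].
  exact: (LP t tc).1.
by apply: Lfar => // ts; rewrite ts in Lts.
Qed.

Lemma not_dir_ccc_star_decomposition : ~ dir_ccc G ->
  exists (T : graph) (V : T -> set G) (c : T),
    [/\ uncountable_star_decomposition V c,
        finite_adhesion V &
        forall t : T, t <> c ->
          exists2 f, is_direction f & direction_lives_in V f t].
Proof.
move=> /existsNP[F /not_implyP[Freg /not_implyP[Ffar nF]]].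
pose VT := {classic option {L | F L}}.
pose e : rel VT := fun x y => (x == None) (+) (y == None).
have esym : symmetric e by move=> x y; rewrite /e addbC.
have eirr : irreflexive e by move=> x; rewrite /e addbb.
pose T := Graph esym eirr.
pose closed_nbhd (L : set G) := [set y | L y \/ exists2 x, L x & adj x y].
(* A closed neighbourhood covers every edge that meets its region; the centre part covers the
   remaining edges. *)
pose V (t : T) := if t is Some L then closed_nbhd (sval L)
  else ~` \bigcup_(L in F) L.
pose c : T := None.
have cstar : is_star c by [].
have far_nbhd A B x : F A -> F B -> A x -> closed_nbhd B x -> A = B.
  move=> FA FB Ax; rewrite /closed_nbhd /= => Bx; apply: contrapT.
  move=> /(Ffar _ _ FA FB) AB; case: Bx => [Bx|[y By yx]].
    by have [] := AB _ _ Ax Bx.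
  by have [_ /negP] := AB _ _ Ax By; apply; rewrite adj_sym.
(* This is what makes the adhesion finite: neighbours of [f X] outside [f X] lie in [X]. *)
have nbhd_fin L : F L -> finite_set (closed_nbhd L `\` L).
  move=> /Freg[f [X [fd <-]]]; apply: (@finite_subfset _ X).
  move=> y [[//|[x fx xy]] nfy]; apply: contrapT => /negP yX.
  by apply: nfy; exact: dir_adj fx xy yX.
have Vadh (L : {L | F L}) :
    V (Some L) `&` V None `<=` closed_nbhd (sval L) `\` sval L.
  move=> x [Lx nx]; split=> // Lx'; apply: nx.
  by exists (sval L) => //; exact: svalP.
(* By [far_nbhd], a common vertex in a member [M] of [F] would force both leaves to be [M]. *)
have VI (K L : {L | F L}) : K <> L -> V (Some K) `&` V (Some L) `<=` V None.
  move=> KL x [Kx Lx] [M FM Mx]; apply: KL.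
  have := far_nbhd _ _ _ FM (svalP K) Mx Kx.
  have := far_nbhd _ _ _ FM (svalP L) Mx Lx.
  by case: K L {Kx Lx} => K FK [L FL] /= -> KL; apply: eq_exist.
exists T, V, c; split.
- split=> //.
  + split.
    * exact: star_is_tree cstar.
    * apply/seteqP; split=> // x _.
      have [[L FL Lx]|nx] := pselect ((\bigcup_(L in F) L) x).
        by exists (Some (exist _ L FL)) => //; left.
      by exists None.
    * move=> x y xy; have [[L FL Lx]|nx] := pselect ((\bigcup_(L in F) L) x).
        by exists (Some (exist _ L FL)); split; [left|right; exists x].
      have [[L FL Ly]|ny] := pselect ((\bigcup_(L in F) L) y).
        exists (Some (exist _ L FL)); split; [right|by left].
        by exists y; rewrite // adj_sym.
      by exists None.
    * move=> t1 t2 t3 p pP t2p.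
      have [->|t12] := pselect (t1 = t2); first by move=> x [].
      have [->|t32] := pselect (t3 = t2); first by move=> x [].
      have [t2c t13] := star_gpath_inner cstar pP t2p t12 t32.
      rewrite t2c in t12 t32 *.
      case: t1 t3 t12 t32 t13 {pP t2p} => [K|] [L|] // _ _ KL.
      by apply: VI => KLE; rewrite KLE in KL.
  + move=> cT; apply: nF.
    pose leaf (L : set G) : T :=
      if pselect (F L) is left FL then Some (exist _ L FL) else None.
    apply: (countable_inj (h := leaf) (B := [set~ c])) => //; rewrite /leaf.
      move=> K L FK FL.
      by case: pselect => // ?; case: pselect => // ? [].
    by move=> L FL; case: pselect.
- have fin t : t <> c -> finite_set (V t `&` V c).
    case: t => [L|] // _; apply: sub_finite_set (Vadh L) _.
    by apply: nbhd_fin; exact: svalP.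
  move=> t1 t2 t12; have [t1c|t1c] := pselect (t1 = c); last first.
    by rewrite (star_adj_leaf cstar t1c t12); exact: fin.
  by rewrite t1c setIC; apply: fin => t2c; rewrite t1c t2c adj_irr in t12.
- case=> [L|] // _; have [f [X [fd fX]]] := Freg _ (svalP L).
  have [r rr rL] := dir_ray X fd; rewrite fX in rL.
  have rd := seq_dirP (ray_eventually_linked rr).
  exists (seq_dir r) => //; exists (ray_class r); split.
  + by exists r.
  + exact: ray_class_direction.
  + exists r; first by split; [|exact: ray_equiv_refl].
    have -> : range r `&` V (Some L) = range r.
      by apply/setIidl => x /rL; left.
    move=> /finite_fsetP[Y rY]; have [n rn] := inj_eventually_notin Y rr.1.
    have /negP := rn n (leqnn n); apply.
    by have : range r (r n) by []; rewrite rY.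
Qed.

End StarDecompositions.

Theorem theorem4 (G : graph) (hG : connected_graph G) :
  ~ countably_determined G <->
  exists (T : graph) (V : T -> set G) (c : T),
    [/\ uncountable_star_decomposition V c,
        finite_adhesion V &
        forall t : T, t <> c ->
          exists2 f, is_direction f & direction_lives_in V f t].
Proof.
split=> [ncd|[T [V [c [Vstar Vfin Vdir]]]] cd].
  apply: not_dir_ccc_star_decomposition => ccc; apply: ncd.
  exact: dir_ccc_countably_determined.
exact: (star_decomposition_not_dir_ccc Vstar Vfin Vdir
  (countably_determined_dir_ccc cd)).
Qed.
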